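(* Let $F_j : \mathbb{R}^m \to \mathbb{R}^m$, $j = 0,\ldots,J-1$, be arbitrary maps, and let $P_j$, $W$, $\Lambda$, $\bar{x}$, $\mathbf{F}$ and $\mathbf{G}^P$ be as defined in the context. Define the set-valued vector field on $\mathbb{R}^n$ $$V(x) = \sum_{j=0}^{J-1} P_j^T W \left( P_j x - F_j^{-1}(P_j x) \right),$$ where $F_j^{-1}(P_j x) = \{ v \in \mathbb{R}^m : F_j(v) = P_j x \}$ is the (possibly empty) set-valued inverse; that is, $V(x)$ is the set of all vectors $\sum_{j=0}^{J-1} P_j^T W (P_j x - v_j)$ with $v_j \in F_j^{-1}(P_j x)$ for every $j$. Then for $x^* \in \mathbb{R}^n$, there is a solution $\mathbf{v}^* \in (\mathbb{R}^m)^J$ of the PMACE equation $\mathbf{F}(\mathbf{v}^* ) = \mathbf{G}^P(\mathbf{v}^* )$ with $x^* = \bar{x}(\mathbf{v}^* )$ if and only if $$0 \in V(x^* ).$$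
   Context: Setting. $J \ge 1$; $P_j$ ($j=0,\ldots,J-1$) is a real $m \times n$ matrix with orthonormal rows, so $P_j P_j^T = I$. $W$ is a (symmetric) positive definite $m \times m$ matrix, and $\Lambda = \sum_{j=0}^{J-1} P_j^T W P_j$ is assumed invertible. For $\mathbf{v} = [v_0,\ldots,v_{J-1}]$ with each $v_j \in \mathbb{R}^m$, define $$\bar{x}(\mathbf{v}) = \Lambda^{-1}\sum_{j=0}^{J-1} P_j^T W v_j \in \mathbb{R}^n, \qquad \mathbf{G}^P(\mathbf{v}) = [P_0 \bar{x}(\mathbf{v}), \ldots, P_{J-1}\bar{x}(\mathbf{v})].$$ Given maps $F_j : \mathbb{R}^m \to \mathbb{R}^m$ (called agents), define $\mathbf{F}(\mathbf{v}) = [F_0(v_0), \ldots, F_{J-1}(v_{J-1})]$. The PMACE equation is $\mathbf{F}(\mathbf{v}^* ) = \mathbf{G}^P(\mathbf{v}^* )$. (Complex images are regarded as real vectors by stacking real and imaginary parts.) *)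

(* Defs.v *)
From mathcomp Require Import all_boot all_order all_algebra.
From mathcomp Require Import boolp classical_sets reals.
Set Implicit Arguments.
Unset Strict Implicit.
Unset Printing Implicit Defensive.
Import Order.TTheory GRing.Theory Num.Theory.
Local Open Scope classical_set_scope.
Local Open Scope ring_scope.

Definition posdefmx (R : realType) (m : nat) (W : 'M[R]_m) : Prop :=
  W^T = W /\ forall u : 'cV[R]_m, u != 0 -> 0 < (u^T *m W *m u) 0 0.

(* The stacked space (R^m)^J; finite functions make equality of stacks the
   same as componentwise equality. *)
Definition stack (R : realType) (m J : nat) := {ffun 'I_J -> 'cV[R]_m}.

Section PMACE.
Variables (R : realType) (m n J : nat).
Variables (P : 'I_J -> 'M[R]_(m, n)) (W : 'M[R]_m) (F : 'I_J -> 'cV[R]_m -> 'cV[R]_m).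

Definition Lambda : 'M[R]_n := \sum_(j < J) (P j)^T *m W *m P j.

(* invmx Lambda is the inverse only when Lambda \in unitmx, which has to be
   assumed separately. *)
Definition xbar (v : stack R m J) : 'cV[R]_n :=
  invmx Lambda *m \sum_(j < J) (P j)^T *m W *m v j.

Definition GP (v : stack R m J) : stack R m J := [ffun j => P j *m xbar v].

Definition stackF (v : stack R m J) : stack R m J := [ffun j => F j (v j)].

Definition PMACE_solution (v : stack R m J) : Prop := stackF v = GP v.

(* The preimage of P_j x under F_j is the set-valued inverse; one v_j is chosen
   from it for each j, so the field is empty at x as soon as one preimage is. *)
Definition vfield (x : 'cV[R]_n) : set 'cV[R]_n :=
  [set \sum_(j < J) (P j)^T *m W *m (P j *m x - v j) | v in
     [set v : stack R m J | forall j, v j \in F j @^-1` [set P j *m x]]].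

End PMACE.

(* Main.v *)
Require Import Defs.
From mathcomp Require Import all_boot all_order all_algebra.
From mathcomp Require Import boolp classical_sets reals.
Set Implicit Arguments.
Unset Strict Implicit.
Unset Printing Implicit Defensive.
Import Order.TTheory GRing.Theory Num.Theory.
Local Open Scope classical_set_scope.
Local Open Scope ring_scope.

(** Summing [P_j^T W (P_j x - v_j)] over [j] gives
    [Lambda x - sum_j P_j^T W v_j = Lambda (x - xbar v)], which vanishes exactly
    when [x = xbar v]; given this, the PMACE equation for [v] reads
    [F_j v_j = P_j x] for all [j]. *)

Lemma sum_residualE (R : realType) (m n J : nat) (P : 'I_J -> 'M[R]_(m, n))
    (W : 'M[R]_m) (v : stack R m J) (x : 'cV[R]_n) :
  Lambda P W \in unitmx ->
  \sum_(j < J) (P j)^T *m W *m (P j *m x - v j) =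
  Lambda P W *m (x - xbar P W v).
Proof.
(* Invertibility makes [Lambda] cancel the [invmx] inside [xbar], leaving two sums to compare term
   by term. *)
move=> uL; rewrite mulmxBr mulKVmx // mulmx_suml -sumrB.
by apply: eq_bigr => j _; rewrite mulmxBr mulmxA.
Qed.

Lemma sum_residual_eq0 (R : realType) (m n J : nat) (P : 'I_J -> 'M[R]_(m, n))
    (W : 'M[R]_m) (v : stack R m J) (x : 'cV[R]_n) :
  Lambda P W \in unitmx ->
  \sum_(j < J) (P j)^T *m W *m (P j *m x - v j) = 0 <-> x = xbar P W v.
Proof.
move=> uL; rewrite sum_residualE //; split=> [Lx0|->]; last first.
  by rewrite subrr mulmx0.
(* [Lambda] is injective: [x - xbar P W v] is recovered by applying [invmx Lambda] to its image,
   which is 0. *)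
by apply/subr0_eq; rewrite -[LHS](mulKmx uL) Lx0 mulmx0.
Qed.

Lemma PMACE_solutionP (R : realType) (m n J : nat) (P : 'I_J -> 'M[R]_(m, n))
    (W : 'M[R]_m) (F : 'I_J -> 'cV[R]_m -> 'cV[R]_m) (v : stack R m J) :
  PMACE_solution P W F v <-> forall j, F j (v j) = P j *m xbar P W v.
Proof.
split=> [/ffunP Fv j|Fv]; first by have := Fv j; rewrite !ffunE.
by apply/ffunP => j; rewrite !ffunE.
Qed.

Theorem mainTheorem3 (R : realType) (m n J : nat) (hJ : (0 < J)%N)
    (P : 'I_J -> 'M[R]_(m, n)) (hP : forall j : 'I_J, P j *m (P j)^T = 1%:M)
    (W : 'M[R]_m) (hW : posdefmx W)
    (hLambda : Lambda P W \in unitmx)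
    (F : 'I_J -> 'cV[R]_m -> 'cV[R]_m) (xstar : 'cV[R]_n) :
  (exists vstar : stack R m J,
     PMACE_solution P W F vstar /\ xstar = xbar P W vstar) <->
  0 \in vfield P W F xstar.
Proof.
rewrite inE; split=> [[v [/PMACE_solutionP Fv xE]]|[v Fv /sum_residual_eq0 xE]].
(* The same stack [v] is the witness in both directions; [xE] exchanges [xstar] and [xbar P W v] in
   the conditions on [F]. *)
- exists v; last exact/sum_residual_eq0.
  by move=> j; apply/mem_set; rewrite /= Fv xE.
(* The view left invertibility of [Lambda] as a premise of [xE]; it is discharged here. *)
- have {}xE := xE hLambda; exists v; split=> //.
  by apply/PMACE_solutionP => j; rewrite -xE; exact: (set_mem (Fv j)).
Qed.
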